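(* Let $\mathbb{A} = \mathbb{Q}^+ \cup \{\infty\}$, equipped with the binary operations $a \oplus b = \min(a,b)$ and $a \otimes b = \frac{ab}{a+b}$ (with $a \otimes \infty = \infty \otimes a = a$ for all $a \in \mathbb{A}$). Then $(\mathbb{A}, \oplus, \otimes)$ is a semiring.
   Context: $\mathbb{Q}^+$ denotes the set of strictly positive rational numbers, and $\infty$ is an additional element larger than every rational number, so $\min(a,\infty)=a$. The operation $\otimes$ is given by $\frac{ab}{a+b}$ for $a,b\in\mathbb{Q}^+$. It is extended to $\infty$ by the limit $a\otimes\infty := \lim_{b\to\infty}\frac{ab}{a+b} = a$ and by commutativity, with $\infty\otimes\infty=\infty$. A semiring is here a structure $\langle \mathbb{S}, \oplus, \otimes\rangle$ consisting of a set $\mathbb{S}$ and two associative binary operations $\oplus,\otimes$ on $\mathbb{S}$ (so $\mathbb{S}$ is closed under both) such that $\oplus$ is commutative and $\otimes$ distributes over $\oplus$, i.e. $x \otimes (y \oplus z) = (x \otimes y) \oplus (x \otimes z)$ for all $x,y,z\in\mathbb{S}$. No neutral elements and no absorption property are required. *)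

(* Defs.v *)
From mathcomp Require Import all_boot all_order all_algebra.
Set Implicit Arguments.
Unset Strict Implicit.
Unset Printing Implicit Defensive.
Import Order.TTheory GRing.Theory Num.Theory.
Local Open Scope ring_scope.

(* Neutral elements and absorption are not required, so this is weaker than
   the library's semirings.  The field [dist] is x * (y + z) = x * y + x * z. *)
Record is_semiring (S : Type) (add mul : S -> S -> S) : Prop := IsSemiring {
  addA : associative add;
  addC : commutative add;
  mulA : associative mul;
  dist : right_distributive mul add
}.

Definition Qpos : Type := {q : rat | 0 < q}.

Lemma min_Qpos_subproof (a b : Qpos) : 0 < Num.min (val a) (val b).
Proof. by rewrite lt_min (valP a) (valP b). Qed.

Definition min_Qpos (a b : Qpos) : Qpos :=
  exist _ (Num.min (val a) (val b)) (min_Qpos_subproof a b).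

Lemma harm_Qpos_subproof (a b : Qpos) :
  0 < val a * val b / (val a + val b).
Proof.
by rewrite divr_gt0 ?mulr_gt0 ?addr_gt0 ?(valP a) ?(valP b).
Qed.

Definition harm_Qpos (a b : Qpos) : Qpos :=
  exist _ (val a * val b / (val a + val b)) (harm_Qpos_subproof a b).

(* [None] is the point at infinity. *)
Definition A : Type := option Qpos.

Definition oplus (a b : A) : A :=
  match a, b with
  | Some p, Some q => Some (min_Qpos p q)
  | x, None => x
  | None, y => y
  end.

Definition otimes (a b : A) : A :=
  match a, b with
  | Some p, Some q => Some (harm_Qpos p q)
  | x, None => x
  | None, y => y
  end.

(* Main.v *)
From mathcomp Require Import all_boot all_order all_algebra.
From mathcomp Require Import ring.
Require Import Defs.
Import Order.TTheory GRing.Theory Num.Theory.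
Local Open Scope ring_scope.

(** The reciprocal, with 1/oo = 0, embeds [A] in the nonnegative rationals and
    carries [min] to [max] and the operation ab/(a+b) to addition, so the axioms
    are inherited from the max-plus semiring. *)

Definition recip (a : A) : rat := if a is Some p then (val p)^-1 else 0.

Lemma recip_ge0 (a : A) : 0 <= recip a.
Proof. by case: a => [p|] //=; rewrite invr_ge0 ltW ?(valP p). Qed.

(** Inversion is injective, and a finite point has a strictly positive reciprocal, so it cannot
    collide with [recip None = 0]. *)
Lemma recip_inj : injective recip.
Proof.
case=> [p|] [q|] //= epq.
- by congr Some; apply/val_inj/invr_inj.
- by have := valP p; rewrite -invr_gt0 epq ltxx.
- by have := valP q; rewrite -invr_gt0 -epq ltxx.
Qed.

(** Inversion reverses the order on positive rationals; [None], neutral for [oplus], goes to 0,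
    which is neutral for max on nonnegative values. *)
Lemma recip_oplus (a b : A) : recip (oplus a b) = Num.max (recip a) (recip b).
Proof.
case: a b => [p|] [q|] /=; last by rewrite maxxx.
- have [pq|qp] := leP (val p) (val q).
    by rewrite max_l // lef_pV2 // posrE ?(valP p) ?(valP q).
  by rewrite max_r // lef_pV2 ?ltW // posrE ?(valP p) ?(valP q).
- by rewrite max_l // (recip_ge0 (Some p)).
- by rewrite max_r // (recip_ge0 (Some q)).
Qed.

Lemma recip_otimes (a b : A) : recip (otimes a b) = recip a + recip b.
Proof.
case: a b => [p|] [q|] /=; rewrite ?addr0 ?add0r //.
have p0 := valP p; have q0 := valP q.
(* The denominators that [field] requires to be nonzero are positive by [p0] and [q0]. *)
by field; rewrite !gt_eqF ?addr_gt0.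
Qed.

Theorem theorem1 : @is_semiring A oplus otimes.
Proof.
split=> [a b c|a b|a b c|a b c]; apply: recip_inj;
  rewrite ?(recip_oplus, recip_otimes).
- exact: maxA.
- exact: maxC.
- exact: addrA.
- exact: addr_maxr.
Qed.
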